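(* Let $\mathcal{H}$ be a complex Hilbert space and let $(\mathcal{T}_t)_{t\ge 0}$ be a quantum dynamical semigroup on $\mathfrak{B}(\mathcal{H})$ of the form $\mathcal{T}_t(X)=\mathbb{E}_{0]}[U_t^\dagger(X\otimes \mathbb{1})U_t]$, with uniformly continuous dynamics. Let $\mathcal{C}_\ast$ be the set of invariant density operators of $(\mathcal{T}_t)_{t\ge0}$. If $\mathcal{C}_\ast$ is non-empty, then it is convex and closed in $(\mathfrak{I}_1(\mathcal{H}),\|\cdot\|_1)$.
   Context: Notation. $\mathfrak{B}(\mathcal{H})$ is the algebra of bounded operators on $\mathcal{H}$; $\mathfrak{I}_1(\mathcal{H})$ is the space of trace-class operators with norm $\|X\|_1=\operatorname{tr}\sqrt{X^\ast X}$; $\mathfrak{S}(\mathcal{H})\subset \mathfrak{I}_1(\mathcal{H})$ is the set of density operators (non-negative, trace one). Quantum dynamical semigroup. A quantum dynamical semigroup (QDS) on $\mathfrak{B}(\mathcal{H})$ is a family of bounded linear maps $\mathcal{T}_t$, $t\ge 0$, with $\mathcal{T}_0=\mathrm{id}$, $\mathcal{T}_{s+t}=\mathcal{T}_s\circ\mathcal{T}_t$, each $\mathcal{T}_t$ completely positive and normally ($\sigma$-weakly) continuous. Here $U_t$ are the unitaries on $\mathcal{H}\otimes\Gamma$ describing the joint evolution of the system and an environment with Fock space $\Gamma$ in the state $\Psi\in\mathfrak{S}(\Gamma)$, and $\mathbb{E}_{0]}$ is the conditional expectation onto the system, so $\operatorname{tr}(\rho\,\mathbb{E}_{0]}[Z])=\operatorname{tr}((\rho\otimes\Psi)Z)$;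 in particular $\mathcal{T}_t(\mathbb{1})=\mathbb{1}$. The predual semigroup on $\mathfrak{I}_1(\mathcal{H})$ is $\mathcal{S}_t(\rho)=\operatorname{tr}_\Gamma(U_t(\rho\otimes\Psi)U_t^\dagger)$, and $\operatorname{tr}(\rho\,\mathcal{T}_t(X))=\operatorname{tr}(\mathcal{S}_t(\rho)X)$. Standing assumption: $\mathcal{T}_t$ is uniformly (norm) continuous in $t$, so its generator $\mathcal{L}$ is bounded. A density operator $\rho$ is invariant if $\operatorname{tr}(\rho\,\mathcal{T}_t(A))=\operatorname{tr}(\rho A)$ for all $A\in\mathfrak{B}(\mathcal{H})$ and $t\ge0$. *)

(* Defs.v *)
From HB Require Import structures.
From mathcomp Require Import all_boot all_order all_algebra perm.
From mathcomp Require Import complex.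
From mathcomp Require Import all_classical all_reals all_analysis.
From mathcomp Require summability.

Set Implicit Arguments.
Unset Strict Implicit.
Unset Printing Implicit Defensive.

Import Order.TTheory GRing.Theory Num.Theory.
Import numFieldNormedType.Exports.

Local Open Scope classical_set_scope.
Local Open Scope ring_scope.

(* MathComp's convention for sesquilinear forms: the inner product is linear
   in its first argument and conjugate-linear in its second one. *)
HB.mixin Record isHilbert (R : realType) H of CompleteNormedModule R[i] H := {
  inner : {dot H for @Num.conj R[i]} ;
  normE_inner : forall x : H, `|x| ^+ 2 = inner x x
}.

#[short(type="hilbertType")]
HB.structure Definition Hilbert (R : realType) :=
  {H of isHilbert R H & CompleteNormedModule R[i] H}.

Notation "''[' u , v ]" := (inner u v) : ring_scope.

Section span.
Context {R : realType} {H : hilbertType R}.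

Definition lin_span (S : set H) : set H :=
  [set x | exists n (c : 'I_n -> R[i]) (v : 'I_n -> H),
     (forall i, S (v i)) /\ x = \sum_i c i *: v i].

Definition total_set (S : set H) := closure (lin_span S) = setT.

Definition orthonormal_basis (B : set H) :=
  (forall e f, B e -> B f -> '[e, f] = (e == f)%:R) /\ total_set B.

End span.

(* A chosen orthonormal basis; the traces below do not depend on this choice. *)
Definition hbasis {R : realType} (H : hilbertType R) : set H :=
  xget set0 [set B | orthonormal_basis B].
Arguments hbasis {R} H _.

Section bounded_operators.
Context {R : realType} {H : hilbertType R}.

Definition is_bop : {pred H -> H} :=
  [pred A | `[< linear A /\
                exists2 M : R[i], 0 <= M & forall x, `|A x| <= M * `|x| >]].

Fact is_bop_submod : submod_closed is_bop.
Proof.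
split.
  apply/asboolP; split; first by move=> a x y /=; rewrite scaler0 addr0.
  by exists 0 => // x; rewrite mul0r normr0.
move=> a A B /asboolP[lA [M M0 AM]] /asboolP[lB [N N0 BN]]; apply/asboolP; split.
  move=> b x y; change (a *: A (b *: x + y) + B (b *: x + y) =
    b *: (a *: A x + B x) + (a *: A y + B y)).
  rewrite lA lB !scalerDr !scalerA [a * b]mulrC -!addrA; congr (_ + _).
  by rewrite addrCA.
exists (`|a| * M + N); first by rewrite addr_ge0// mulr_ge0.
move=> x; change (`|a *: A x + B x| <= (`|a| * M + N) * `|x|).
rewrite (le_trans (ler_normD _ _))// mulrDl lerD// normrZ -mulrA.
exact: ler_wpM2l.
Qed.

HB.instance Definition _ :=
  GRing.isSubmodClosed.Build R[i] (H -> H) is_bop is_bop_submod.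

Fact is_bop_id : @id H \in is_bop.
Proof.
by apply/asboolP; split => //; exists 1 => // x; rewrite mul1r.
Qed.

Fact is_bop_comp (A B : H -> H) :
  A \in is_bop -> B \in is_bop -> A \o B \in is_bop.
Proof.
move=> /asboolP[lA [M M0 AM]] /asboolP[lB [N N0 BN]]; apply/asboolP; split.
  by move=> a x y; rewrite /= lB lA.
exists (M * N); first exact: mulr_ge0.
move=> x; rewrite -mulrA (le_trans (AM _))//; exact: ler_wpM2l.
Qed.

End bounded_operators.

Record bop {R : realType} (H : hilbertType R) :=
  Bop { bop_fun :> H -> H ; bopP : bop_fun \in is_bop }.

HB.instance Definition _ (R : realType) (H : hilbertType R) :=
  [isSub for @bop_fun R H].
HB.instance Definition _ (R : realType) (H : hilbertType R) :=
  [Choice of bop H by <:].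
HB.instance Definition _ (R : realType) (H : hilbertType R) :=
  [SubChoice_isSubLmodule of bop H by <:].

Section bop_ring.
Context {R : realType} {H : hilbertType R}.
Implicit Types A B D : bop H.

Definition bop1 : bop H := Bop is_bop_id.
Definition bop_mul A B : bop H := Bop (is_bop_comp (bopP A) (bopP B)).

Fact bop_mulA : associative bop_mul. Proof. by move=> A B D; exact/val_inj. Qed.
Fact bop_mul1 : left_id bop1 bop_mul. Proof. by move=> A; exact/val_inj. Qed.
Fact bop_mulr1 : right_id bop1 bop_mul. Proof. by move=> A; exact/val_inj. Qed.
Fact bop_mulDl : left_distributive bop_mul +%R.
Proof. by move=> A B D; exact/val_inj. Qed.
Fact bop_mulDr : right_distributive bop_mul +%R.
Proof.
move=> A B D; apply/val_inj/funext => x /=.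
have /asboolP[lA _] := bopP A.
by have := lA 1 (B x) (D x); rewrite !scale1r.
Qed.

HB.instance Definition _ := GRing.Zmodule_isPzRing.Build (bop H)
  bop_mulA bop_mul1 bop_mulr1 bop_mulDl bop_mulDr.

End bop_ring.

Section operator_theory.
Context {R : realType} {H : hilbertType R}.
Implicit Types A X P : bop H.

Definition opnorm A : R := sup [set complex.Re `|A x| | x in [set x : H | `|x| <= 1]].

(* Below, [xget 0 P] is the operator satisfying [P], which exists and is unique
   in each case where it is used (0 is a dummy default). *)
Definition adjoint A : bop H :=
  xget 0 [set B : bop H | forall x y, '[A x, y] = '[x, B y]].

Definition unitary (U : bop H) := adjoint U * U = 1 /\ U * adjoint U = 1.

(* The order on R[i] makes [0 <= z] say that [z] is real and nonnegative. *)
Definition positive_op A := forall x, 0 <= '[A x, x].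

Definition sqrt_op P : bop H :=
  xget 0 [set Q : bop H | positive_op Q /\ Q * Q = P].

Definition abs_op A : bop H := sqrt_op (adjoint A * A).

(* The trace of the positive operator [abs_op X] is always defined in [0, +oo];
   [tr] below is meant for trace-class arguments only. *)
Definition trace_norm X : \bar R :=
  (\esum_(e in hbasis H) (complex.Re '[abs_op X e, e])%:E)%R.

Definition trace_class : set (bop H) := [set X | (trace_norm X < +oo)%E].

(* Unordered sum: limit along the finite subsets of the basis. *)
Definition tr A : R[i]^o :=
  summability.sum (fun e : hbasis H => '[A (val e), val e] : R[i]^o).

Definition density : set (bop H) :=
  [set rho | [/\ positive_op rho, trace_class rho & tr rho = 1]].

(* Closedness in the normed space of trace-class operators: [C] contains each of
   its points of closure [X]. *)
Definition trace_norm_closed (C : set (bop H)) :=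
  forall X, trace_class X ->
    (forall eps : R, 0 < eps ->
       exists2 Y, C Y & (trace_norm (X - Y)%R < eps%:E)%E) ->
    C X.

(* Convergence of a filter in the sigma-weak topology, the initial topology of
   the functionals [X |-> tr (rho * X)] with [rho] of trace class. *)
Definition sigma_weak_cvg (F : set_system (bop H)) X :=
  forall rho, trace_class rho -> tr (rho * Y) @[Y --> F] --> tr (rho * X).

Definition normal_map (Phi : bop H -> bop H) :=
  forall (F : set_system (bop H)) X, ProperFilter F ->
    sigma_weak_cvg F X -> sigma_weak_cvg (Phi @ F) (Phi X).

(* Positivity of [A] as an operator on the n-fold direct sum of [H]. *)
Definition positive_mx n (A : 'M[bop H]_n) :=
  forall v : 'I_n -> H, 0 <= \sum_i \sum_j '[A i j (v j), v i].

Definition completely_positive (Phi : bop H -> bop H) :=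
  forall n (A : 'M[bop H]_n), positive_mx A -> positive_mx (map_mx Phi A).

Definition bounded_map (Phi : bop H -> bop H) :=
  exists M : R, forall X, opnorm (Phi X) <= M * opnorm X.

Definition map_norm (Phi : bop H -> bop H) : R :=
  sup [set opnorm (Phi X) | X in [set X | opnorm X <= 1]].

(* The time set is [0, +oo[: the values [T t] with [t < 0] are irrelevant. *)
Record qds (T : R -> {linear bop H -> bop H}) : Prop := {
  qds_bounded : forall t, 0 <= t -> bounded_map (T t) ;
  qds_cp : forall t, 0 <= t -> completely_positive (T t) ;
  qds_normal : forall t, 0 <= t -> normal_map (T t) ;
  qds_0 : forall X, T 0 X = X ;
  qds_D : forall s t X, 0 <= s -> 0 <= t -> T (s + t) X = T s (T t X)
}.

Definition norm_continuous_family (T : R -> {linear bop H -> bop H}) :=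
  forall t, 0 <= t ->
    map_norm (T s \- T t) @[s --> within [set s | 0 <= s] (nbhs t)] --> (0 : R).

Definition invariant_density (T : R -> {linear bop H -> bop H}) :
    set (bop H) :=
  [set rho | density rho /\
     forall A t, 0 <= t -> tr (rho * T t A) = tr (rho * A)].

End operator_theory.

Section tensor.
Context {R : realType} {H G K : hilbertType R}.

(* [K], with [tens a c] as the elementary tensors, is the completed tensor
   product of [H] and [G]; this determines [K] up to a unique unitary. *)
Definition hilbert_tensor (tens : {bilinear H -> G -> K}) :=
  (forall a b c d, '[tens a c, tens b d] = '[a, b] * '[c, d]) /\
  total_set [set tens a c | a in setT & c in setT].

Definition tensor_op (tens : {bilinear H -> G -> K}) (A : bop H) (B : bop G) :
    bop K :=
  xget 0 [set Z : bop K | forall a c, Z (tens a c) = tens (A a) (B c)].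

Definition conditional_expectation (tens : {bilinear H -> G -> K})
    (Psi : bop G) (E : bop K -> bop H) :=
  forall Z rho, density rho -> tr (rho * E Z) = tr (tensor_op tens rho Psi * Z).

End tensor.

Variant statistics := Bose | Fermi | Boltzmann.

Definition statistics_weight (R : realType) (q : statistics) n (s : 'S_n) :
    R[i] :=
  match q with
  | Bose => 1
  | Fermi => (-1) ^+ s
  | Boltzmann => (s == 1%g)%:R
  end.

(* [G] is the (symmetric, antisymmetric or full) Fock space over the
   one-particle space [h]: [iota n f] is the n-particle vector obtained from the
   vacuum by creating [f 0, ..., f (n - 1)]. Sectors of different particle
   numbers are orthogonal, the inner product of an n-particle sector is the
   permanent, the determinant or the product of the one-particle inner products,
   and these vectors are total; this determines [G] up to a unique unitary. *)
Definition fock_space (R : realType) (q : statistics) (h G : hilbertType R)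
    (iota : forall n, ('I_n -> h) -> G) :=
  [/\ forall n m (f : 'I_n -> h) (g : 'I_m -> h), n <> m ->
        '[iota n f, iota m g] = 0,
      forall n (f g : 'I_n -> h),
        '[iota n f, iota n g] =
          \sum_(s : 'S_n) statistics_weight R q s * \prod_i '[f i, g (s i)]
    & total_set [set x | exists n (f : 'I_n -> h), x = iota n f]].

(* Main.v *)
(* For a fixed bounded operator A, X |-> tr (X A) is linear, and
   |tr (Z A)| <= C_A |Z|_1 for self-adjoint Z. Hence the equations tr X = 1 and
   tr (X T_t(A)) = tr (X A) pass to convex combinations and to trace norm
   limits; so does positivity, since |Z x| <= |Z|_1 |x|. Both estimates rest on
   -|Z| <= Z <= |Z|, which follows from the fact that P >= 0 and
   |Z x| <= |P x| for all x imply Z <= P; this also gives the uniqueness of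
   positive square roots. *)
Require Import Defs.
From mathcomp Require Import all_boot all_order all_algebra complex.
From mathcomp Require Import all_classical all_reals all_analysis.
From mathcomp Require Import finmap ring lra.
From mathcomp Require summability.
Import Order.TTheory GRing.Theory Num.Theory.
Import numFieldNormedType.Exports.
Local Open Scope classical_set_scope.
Local Open Scope ring_scope.
Set Implicit Arguments.
Unset Strict Implicit.
Unset Printing Implicit Defensive.
Local Open Scope complex_scope.

(** * Inner products *)

(** [adjoint], [sqrt_op] and [hbasis] are [xget] choices and [tr] is a [lim], so each may be a dummy
    value until existence is proved; this shapes the proof. Square roots are limits of a quadratic
    iteration dominated by a scalar one, adjoints come from the Riesz representation, and traces of
    products from absolute summability. The basis itself is extracted from the assumed invariant
    density, whose trace is 1. Trace computations go through positive operators: for P >= 0 one has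
    |P| = P, so the trace norm of P is the sum of its diagonal and is additive. If |A x| <= M |x|,
    Cauchy-Schwarz bounds |<P A e, e>| by <P A e, A e> + <P e, e>, and summing over the basis gives
    at most (M^2 + 1) tr P; this is the origin of C_A = 3 (M^2 + 1). *)

Section norm.
Context {R : realType} {V : normedZmodType R[i]}.
Implicit Types x y : V.

Definition rnorm x : R := complex.Re `|x|.

Lemma rnormE x : `|x| = (rnorm x)%:C.
Proof. by rewrite /rnorm RRe_real// ger0_real. Qed.

Lemma rnorm_ge0 x : 0 <= rnorm x.
Proof. by rewrite -ler0c -rnormE. Qed.

Lemma rnormD x y : rnorm (x + y) <= rnorm x + rnorm y.
Proof. by rewrite -lecR rmorphD /= -!rnormE ler_normD. Qed.

Lemma rnormN x : rnorm (- x) = rnorm x.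
Proof. by rewrite /rnorm normrN. Qed.

Lemma rnorm0 : rnorm (0 : V) = 0.
Proof. by rewrite /rnorm normr0. Qed.

Lemma rnorm_distC x y : rnorm (x - y) = rnorm (y - x).
Proof. by rewrite /rnorm distrC. Qed.

Lemma rnorm0_eq0 x : rnorm x = 0 -> x = 0.
Proof. by move=> h; apply/eqP; rewrite -normr_eq0 rnormE h. Qed.

End norm.

(** Positive elements of [R[i]] are real, so real radii suffice. This is the form of completeness
    used for square roots, for the Riesz vector and for unordered sums. *)
Lemma rnorm_cauchy {R : realType} {V : completeNormedModType R[i]}
    (F : set_system V) {FF : ProperFilter F} :
  (forall e : R, 0 < e -> exists x, F [set y | rnorm (y - x) < e]) ->
  exists l, forall e : R, 0 < e -> F [set y | rnorm (y - l) < e].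
Proof.
move=> h.
have /cauchy_cvgP cF : cauchy F.
  apply: cauchy_exP => e e0.
  have re : e = (complex.Re e)%:C by rewrite RRe_real// gtr0_real.
  have [|x Fx] := h (complex.Re e); first by rewrite -ltcR -re.
  exists x; apply: filterS Fx => y /=.
  by rewrite -ball_normE /= -ltcR -re -rnormE distrC.
exists (lim F) => e e0.
have /cvgrPdist_lt /(_ e%:C) := cF; rewrite ltcR => /(_ e0).
by apply: filterS => y /=; rewrite rnormE ltcR rnorm_distC.
Qed.

Section scale.
Context {R : realType} {V : normedModType R[i]}.

Lemma rnormZ (a : R[i]) (x : V) : rnorm (a *: x) = rnorm a * rnorm x.
Proof. by apply: complexI; rewrite rmorphM /= -!rnormE normrZ. Qed.

End scale.

Lemma rnormC {R : realType} (a : R) : rnorm a%:C = `|a|.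
Proof.
by rewrite /rnorm normc_def/= expr0n addr0 sqrtr_sqr.
Qed.

Lemma rnormCi {R : realType} : rnorm ('i : R[i]) = 1.
Proof.
by rewrite /rnorm normc_def/= expr0n expr1n add0r sqrtr1.
Qed.

Lemma ReD {R : realType} (a b : R[i]) :
  complex.Re (a + b) = complex.Re a + complex.Re b.
Proof. by case: a; case: b. Qed.

Lemma ReN {R : realType} (a : R[i]) : complex.Re (- a) = - complex.Re a.
Proof. by case: a. Qed.

Lemma ReMr {R : realType} (k : R) (a : R[i]) :
  complex.Re (k%:C * a) = k * complex.Re a.
Proof. by case: a => u v /=; rewrite mul0r subr0. Qed.

Lemma rnorm_conj {R : realType} (a : R[i]) : rnorm (Num.conj a) = rnorm a.
Proof. by rewrite /rnorm norm_conjC. Qed.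

(** Rotating by [u] turns a modulus into a real part, so that estimates for [rip] extend to complex
    inner products. *)
Lemma phase {R : realType} (c : R[i]) :
  exists2 u : R[i], u * Num.conj u = 1 & rnorm c = complex.Re (u * c).
Proof.
have [->|c0] := eqVneq c 0.
  by exists 1; rewrite ?rmorph1 ?mulr1 ?mulr0 ?rnorm0.
exists (Num.conj c / `|c|).
  by rewrite -normCK normf_div norm_conjC normr_id divff ?expr1n// normr_eq0.
congr complex.Re.
by rewrite mulrAC (mulrC (Num.conj _)) -normCK expr2 mulfK// normr_eq0.
Qed.

(** Discriminant criterion behind the Cauchy-Schwarz inequalities and the variational step of
    [riesz]. The degenerate case [b = 0] matters because a positive form may vanish on nonzero
    vectors. *)
Lemma discr_le {R : realFieldType} (a b c : R) : 0 <= b ->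
  (forall t, 0 <= a + t * (2 * c) + t ^+ 2 * b) -> c ^+ 2 <= a * b.
Proof.
rewrite le0r => /predU1P[->|b0] h.
  rewrite mulr0; have [->|c0] := eqVneq c 0; first by rewrite expr0n.
  have := h (- (a + 1) / (2 * c)).
  rewrite mulr0 addr0 divfK ?mulf_neq0 ?pnatr_eq0//; lra.
have := h (- c / b); rewrite -(pmulr_lge0 _ b0).
have -> : (a + - c / b * (2 * c) + (- c / b) ^+ 2 * b) * b = a * b - c ^+ 2.
  by field; rewrite gt_eqF.
by rewrite subr_ge0.
Qed.

Lemma le0_eps {R : realFieldType} (a K : R) :
  (forall e : R, 0 < e -> a <= e * K) -> a <= 0.
Proof.
move=> h; rewrite leNgt; apply/negP => a0.
have K0 : 0 < K by have := h 1 ltr01; rewrite mul1r; exact: lt_le_trans.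
have := h (a / (2 * K)); rewrite divr_gt0 ?mulr_gt0// => /(_ isT).
have -> : a / (2 * K) * K = a / 2 by field; rewrite gt_eqF.
lra.
Qed.

Section inner.
Context {R : realType} {H : hilbertType R}.
Implicit Types x y z : H.

(** The underlying real inner product keeps estimates in the ordered field [R]; [innerE] recovers
    the complex one. *)
Definition rip x y : R := complex.Re '[x, y].

Lemma innerC x y : '[y, x] = Num.conj '[x, y].
Proof. by rewrite hermC expr0 mul1r. Qed.

Lemma innerZr (a : R[i]) x y : '[x, a *: y] = Num.conj a * '[x, y].
Proof. by rewrite linearZr_LR. Qed.

Lemma innerZl (a : R[i]) x y : '[a *: x, y] = a * '[x, y].
Proof. by rewrite linearZl_LR. Qed.

Lemma ripC x y : rip y x = rip x y.
Proof. by rewrite /rip innerC; case: '[x, y]. Qed.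

Lemma ripDl x y z : rip (x + y) z = rip x z + rip y z.
Proof. by rewrite /rip linearDl ReD. Qed.

Lemma ripDr x y z : rip z (x + y) = rip z x + rip z y.
Proof. by rewrite ripC ripDl !(ripC z). Qed.

Lemma ripNl x z : rip (- x) z = - rip x z.
Proof. by rewrite /rip linearNl ReN. Qed.

Lemma ripNr x z : rip z (- x) = - rip z x.
Proof. by rewrite ripC ripNl ripC. Qed.

Lemma ripBl x y z : rip (x - y) z = rip x z - rip y z.
Proof. by rewrite ripDl ripNl. Qed.

Lemma ripBr x y z : rip z (x - y) = rip z x - rip z y.
Proof. by rewrite ripDr ripNr. Qed.

Lemma rip0l z : rip 0 z = 0.
Proof. by rewrite -(subrr z) ripBl subrr. Qed.

Lemma ripZl (a : R) x y : rip (a%:C *: x) y = a * rip x y.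
Proof. by rewrite /rip innerZl ReMr. Qed.

Lemma ripZr (a : R) x y : rip x (a%:C *: y) = a * rip x y.
Proof. by rewrite ripC ripZl ripC. Qed.

Lemma ripxx x : rip x x = rnorm x ^+ 2.
Proof.
rewrite /rip -normE_inner rnormE; apply: complexI.
by rewrite -rmorphXn /=.
Qed.

Lemma innerE x y : '[x, y] = rip x y +i* rip x ('i *: y).
Proof.
rewrite /rip innerZr; case: '[x, y] => u v /=.
by congr (_ +i* _); simpc; ring.
Qed.

Lemma rip_ext x y : (forall z, rip x z = rip y z) -> x = y.
Proof.
move=> h; apply/eqP; rewrite -subr_eq0; apply/eqP/rnorm0_eq0/eqP.
by rewrite -sqrf_eq0 -ripxx ripBl h subrr.
Qed.

Lemma rnormD2 x y :
  rnorm (x + y) ^+ 2 = rnorm x ^+ 2 + 2 * rip x y + rnorm y ^+ 2.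
Proof. by rewrite -!ripxx ripDl !ripDr (ripC x y); ring. Qed.

Lemma rnormB2 x y :
  rnorm (x - y) ^+ 2 = rnorm x ^+ 2 - 2 * rip x y + rnorm y ^+ 2.
Proof. by rewrite rnormD2 rnormN ripNr; ring. Qed.

Lemma ler_norm_rip x y : `|rip x y| <= rnorm x * rnorm y.
Proof.
rewrite -(@ler_pXn2r _ 2)// ?nnegrE ?mulr_ge0 ?rnorm_ge0//.
rewrite real_normK ?num_real// exprMn; apply: discr_le => [|t].
  exact: sqr_ge0.
have := sqr_ge0 (rnorm (x + t%:C *: y)).
rewrite rnormD2 ripZr rnormZ rnormC exprMn real_normK ?num_real//.
by congr (_ <= _); ring.
Qed.

Lemma ler_rip x y : rip x y <= rnorm x * rnorm y.
Proof. by rewrite (le_trans (ler_norm _))// ler_norm_rip. Qed.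

Lemma ler_rnorm_inner x y : rnorm '[x, y] <= rnorm x * rnorm y.
Proof.
have [u uu ->] := phase '[x, y].
have u1 : rnorm u = 1.
  apply/eqP; rewrite -(@eqrXn2 _ 2) ?rnorm_ge0// expr1n; apply/eqP.
  by apply: complexI; rewrite rmorphXn /= -rnormE normCK uu.
rewrite -innerZl; have := ler_rip (u *: x) y.
by rewrite rnormZ u1 mul1r.
Qed.

End inner.

(** * Positive operators *)

Section operators.
Context {R : realType} {H : hilbertType R}.
Implicit Types (x y z : H) (A B P Q Z : bop H).

Lemma bop_linear A : linear A.
Proof. by case: A => f /= /asboolP[]. Qed.

Lemma bopD A x y : A (x + y) = A x + A y.
Proof. by have := bop_linear A 1 x y; rewrite !scale1r. Qed.

Lemma bop0 A : A 0 = 0.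
Proof. by apply: (addrI (A 0)); rewrite -bopD !addr0. Qed.

Lemma bopZ A a x : A (a *: x) = a *: A x.
Proof. by have := bop_linear A a x 0; rewrite bop0 !addr0. Qed.

Lemma bopN A x : A (- x) = - A x.
Proof. by rewrite -scaleN1r bopZ scaleN1r. Qed.

Lemma bopB A x y : A (x - y) = A x - A y.
Proof. by rewrite bopD bopN. Qed.

Lemma bop_bound A :
  exists2 M : R, 0 < M & forall x, rnorm (A x) <= M * rnorm x.
Proof.
have /asboolP[_ [M M0 AM]] := bopP A.
have re : M = (complex.Re M)%:C by rewrite RRe_real// ger0_real.
exists (complex.Re M + 1); first by rewrite ltr_wpDl// -ler0c -re.
move=> x; have := AM x; rewrite !rnormE re -rmorphM lecR => /le_trans; apply.
by rewrite ler_wpM2r ?rnorm_ge0// lerDl.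
Qed.

Lemma is_bop_real (f : H -> H) (M : R) : linear f ->
  (forall x, rnorm (f x) <= M * rnorm x) -> f \in is_bop.
Proof.
move=> lf fM; apply/asboolP; split => //.
exists `|M|%:C; first by rewrite ler0c.
move=> x; rewrite !rnormE -rmorphM lecR (le_trans (fM x))//.
by rewrite ler_wpM2r ?rnorm_ge0// ler_norm.
Qed.

Lemma bopE_add A B x : (A + B) x = A x + B x. Proof. by []. Qed.
Lemma bopE_opp A x : (- A) x = - A x. Proof. by []. Qed.
Lemma bopE_scale a A x : (a *: A) x = a *: A x. Proof. by []. Qed.
Lemma bopE_mul A B x : (A * B) x = A (B x). Proof. by []. Qed.
Lemma bopE_one x : (1 : bop H) x = x. Proof. by []. Qed.
Lemma bopE_zero x : (0 : bop H) x = 0. Proof. by []. Qed.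

Definition bopE :=
  (bopE_add, bopE_opp, bopE_scale, bopE_mul, bopE_one, bopE_zero).

Lemma bop_ext A B : A =1 B -> A = B.
Proof. by move=> h; apply/val_inj/funext. Qed.

(** Since [A] commutes with multiplication by ['i], this real condition gives the complex identity;
    see [selfadjoint_inner]. *)
Definition selfadjoint A := forall x y, rip (A x) y = rip x (A y).

Lemma rip_i x y : rip ('i *: x) ('i *: y) = rip x y.
Proof.
rewrite /rip innerZl innerZr mulrA -normCK.
by rewrite rnormE rnormCi expr1n mul1r.
Qed.

Lemma scale_ii x : 'i *: ('i *: x) = - x.
Proof. by rewrite scalerA -expr2 sqr_i scaleN1r. Qed.

(** Polarization over the complex numbers: the imaginary part of <A x, x> is [rip (A x) ('i *: x)],
    and expanding it at x + i y leaves [rip (A y) x - rip (A x) y]. *)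
Lemma positive_opP A :
  positive_op A <-> selfadjoint A /\ forall x, 0 <= rip (A x) x.
Proof.
split=> [pA|[sA pA] x].
  have r0 x : rip (A x) ('i *: x) = 0.
    by have /ger0_Im := pA x; rewrite innerE.
  split=> [x y|x]; last by have := pA x; rewrite innerE lecE => /andP[].
  have := r0 (x + 'i *: y).
  rewrite bopD scalerDr !(ripDl, ripDr) !r0 scale_ii bopZ rip_i ripNr.
  by rewrite (ripC (A y) x) => /eqP; rewrite add0r addr0 addrC subr_eq0 => /eqP.
rewrite innerE lecE /= pA andbT.
have : rip (A x) ('i *: x) = - rip (A x) ('i *: x).
  by rewrite {1}sA bopZ -rip_i scale_ii ripNr ripC.
lra.
Qed.

Section pos.
Variable P : bop H.
Hypothesis pP : positive_op P.

Lemma pos_selfadjoint : selfadjoint P. Proof. by case/positive_opP: pP. Qed.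
Lemma pos_ge0 x : 0 <= rip (P x) x. Proof. by case/positive_opP: pP. Qed.

Lemma pos_CauchySchwarz x y : rip (P x) y ^+ 2 <= rip (P x) x * rip (P y) y.
Proof.
apply: discr_le => [|t]; first exact: pos_ge0.
have := pos_ge0 (x + t%:C *: y).
rewrite bopD bopZ !(ripDl, ripDr, ripZl, ripZr).
rewrite (pos_selfadjoint y x) (ripC (P x) y).
by congr (_ <= _); ring.
Qed.

(** Cauchy-Schwarz for the form of [P] at [x] and [P x], divided by |P x|^2. A small value of the
    form thus forces a small vector [P x]. *)
Lemma pos_norm_sqr K x : (forall y, rip (P y) y <= K * rnorm y ^+ 2) ->
  0 <= K -> rnorm (P x) ^+ 2 <= K * rip (P x) x.
Proof.
move=> PK K0; have := pos_CauchySchwarz x (P x); rewrite ripxx.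
set n := rnorm (P x) ^+ 2 => h.
have [n0|n0] := eqVneq n 0; first by rewrite n0 mulr_ge0// pos_ge0.
have np : 0 < n by rewrite lt_def n0 sqr_ge0.
rewrite -(ler_pM2r np) -expr2 (le_trans h)// -/n mulrAC mulrC (mulrC (K * n)).
rewrite mulrC ler_wpM2l ?pos_ge0//; exact: PK.
Qed.

Lemma pos_norm K x : (forall y, rip (P y) y <= K * rnorm y ^+ 2) ->
  0 <= K -> rnorm (P x) <= K * rnorm x.
Proof.
move=> PK K0; rewrite -(@ler_pXn2r _ 2)// ?nnegrE ?mulr_ge0 ?rnorm_ge0//.
rewrite (le_trans (pos_norm_sqr x PK K0))// exprMn expr2 -mulrA ler_wpM2l//.
Qed.

End pos.

(* If [Z - P] had a positive supremum [l] of its quadratic form, an approximate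
   eigenvector [x] would satisfy [Z x ~ P x + l x], and then
   [|Z x|^2 ~ |P x|^2 + 2 l <P x, x> + l^2 |x|^2 > |P x|^2]. *)
Lemma selfadjoint_le_of_norm P Z : positive_op P -> selfadjoint Z ->
  (forall x, rnorm (Z x) <= rnorm (P x)) ->
  forall x, rip (Z x) x <= rip (P x) x.
Proof.
move=> pP sZ ZP x0; rewrite leNgt; apply/negP => Dx0.
have [M M0 PM] := bop_bound P.
pose D x := rip (Z x) x - rip (P x) x.
have ZM x : rnorm (Z x) <= M * rnorm x by rewrite (le_trans (ZP x)).
have DM x : `|D x| <= 2 * M * rnorm x ^+ 2.
  rewrite /D (le_trans (ler_normB _ _))//.
  have := ler_norm_rip (Z x) x; have := ler_norm_rip (P x) x.
  have := ZM x; have := PM x.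
  have := rnorm_ge0 x; nra.
have DZ (k : R) x : D (k%:C *: x) = k ^+ 2 * D x.
  by rewrite /D !bopZ !(ripZl, ripZr); ring.
pose S := [set D x | x in [set x | rnorm x <= 1]].
have ubS : ubound S (2 * M).
  move=> _ [x /= x1 <-]; rewrite (le_trans (ler_norm _))// (le_trans (DM x))//.
  by have : rnorm x ^+ 2 <= 1 by [rewrite exprn_ile1 ?rnorm_ge0]; nra.
have supS : has_sup S.
  by split; [exists (D 0), 0 => //=; rewrite rnorm0 | exists (2 * M)].
pose l := sup S.
have Dl x : D x <= l * rnorm x ^+ 2.
  have [x00|x00] := eqVneq (rnorm x) 0.
    rewrite x00 expr0n mulr0; move: (DM x).
    by rewrite x00 expr0n mulr0 normr_le0 => /eqP->.
  have xp : 0 < rnorm x by rewrite lt_def x00 rnorm_ge0.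
  have : D ((rnorm x)^-1%:C *: x) <= l.
    apply: (sup_upper_bound supS); exists ((rnorm x)^-1%:C *: x) => //=.
    by rewrite rnormZ rnormC ger0_norm ?invr_ge0 ?rnorm_ge0// mulVf.
  by rewrite DZ exprVn ler_pdivrMl ?exprn_gt0// mulrC.
have l0 : 0 < l.
  rewrite ltNge; apply/negP => l0; have := Dl x0.
  have := mulr_le0_ge0 l0 (sqr_ge0 (rnorm x0)); rewrite /D; lra.
have l2M : l <= 2 * M by exact: (ge_sup supS.1 ubS).
(* The form of [N] is l |x|^2 - D x >= 0, small at near-maximizers of [D]; by [pos_norm_sqr] the
   vector [N x] is then small, which makes [x] an approximate eigenvector. *)
pose N : bop H := l%:C *: (1 : bop H) - (Z - P).
have NE x : rip (N x) x = l * rnorm x ^+ 2 - D x.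
  by rewrite /N !bopE ripBl ripZl ripxx ripBl.
have pN : positive_op N.
  apply/positive_opP; split=> [x y|x]; last by rewrite NE subr_ge0.
  by rewrite /N !bopE !(ripBl, ripBr, ripZl, ripZr) sZ (pos_selfadjoint pP).
pose K := 4 * M.
have K0 : 0 < K by rewrite /K; lra.
have NK x : rip (N x) x <= K * rnorm x ^+ 2.
  rewrite NE /K; have := DM x; rewrite ler_norml => /andP[+ _].
  have := ler_wpM2r (sqr_ge0 (rnorm x)) l2M; lra.
(* [r] will bound |N x|: comparing norms gives l^2 |x|^2 <= (2 M + 1) r <= l^2 / 4. In [d], the
   bound r^2 / K yields |N x| <= r, and l / 2 yields l |x|^2 >= l / 2, hence the contradiction l^2
   |x|^2 >= l^2 / 2. *)
pose r := Num.min 1 (l ^+ 2 / (4 * (2 * M + 1))).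
have r0 : 0 < r.
  rewrite /r lt_min ltr01 divr_gt0 ?exprn_gt0//.
  by rewrite mulr_gt0// addr_gt0// mulr_gt0.
pose d := Num.min (l / 2) (r ^+ 2 / K).
have d0 : 0 < d by rewrite /d lt_min !divr_gt0// exprn_gt0.
have [_ [x /= x1 <-] lx] := sup_adherent d0 supS.
have Nr : rnorm (N x) <= r.
  rewrite -(@ler_pXn2r _ 2)// ?nnegrE ?rnorm_ge0 ?(ltW r0)//.
  rewrite (le_trans (pos_norm_sqr pN x NK (ltW K0)))//.
  rewrite mulrC -ler_pdivlMr// (@le_trans _ _ d)//; last first.
    by rewrite /d ge_min lexx orbT.
  rewrite NE; have : l * rnorm x ^+ 2 <= l.
    by rewrite ler_piMr ?(ltW l0)// exprn_ile1 ?rnorm_ge0.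
  rewrite -/l in lx; lra.
have ZE : P x + l%:C *: x = Z x + N x.
  by rewrite /N !bopE opprB addrCA addrC; congr (_ + _); rewrite addrC subrK.
have h1 : rnorm (P x + l%:C *: x) <= rnorm (P x) + r.
  by rewrite ZE (le_trans (rnormD _ _))// lerD.
have h2 := rnormD2 (P x) (l%:C *: x).
have dl : d <= l / 2 by rewrite /d ge_min lexx.
have rl : r <= 1 by rewrite /r ge_min lexx.
have rl' : r * (4 * (2 * M + 1)) <= l ^+ 2.
  rewrite -ler_pdivlMr; first by rewrite /r ge_min lexx orbT.
  by rewrite mulr_gt0// addr_gt0// mulr_gt0.
move: h2; rewrite ripZr rnormZ rnormC (ger0_norm (ltW l0)) exprMn.
have := pos_ge0 pP x; have := rnorm_ge0 (P x + l%:C *: x).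
have := Dl x; have := PM x; have := rnorm_ge0 x; have := rnorm_ge0 (P x).
rewrite -/l in lx.
move: h1 x1 lx.
set a := rnorm (P x + _); set p := rnorm (P x); set n := rnorm x.
set q := rip (P x) x => h1 x1 lx p0 n0 pM Dx a0 q0 e.
have pM' : p <= M by nra.
have a2 : a ^+ 2 <= (p + r) ^+ 2 by rewrite ler_pXn2r// nnegrE addr_ge0// ltW.
have h3 : l ^+ 2 * n ^+ 2 <= 2 * M * r + r.
  have lq : 0 <= l * q by rewrite mulr_ge0// ltW.
  have rr : r ^+ 2 <= r by rewrite expr2 ler_piMl// ltW.
  have pr : p * r <= M * r by rewrite ler_wpM2r// ltW.
  rewrite sqrrD in a2; nra.
have h4 : l / 2 <= l * n ^+ 2 by lra.
have h5 : l ^+ 2 / 2 <= l ^+ 2 * n ^+ 2.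
  by rewrite !expr2 -!mulrA ler_wpM2l// ltW.
have : 0 < l ^+ 2 by rewrite exprn_gt0.
nra.
Qed.

End operators.

(** * Square roots, adjoints and absolute values *)

Section sqrt.
Context {R : realType} {H : hilbertType R}.
Implicit Types (x y z : H) (A B P Q Z : bop H).

Lemma rnorm_eps x (K : R) : (forall e : R, 0 < e -> rnorm x <= e * K) -> x = 0.
Proof.
move=> h; apply: rnorm0_eq0; apply/eqP; rewrite eq_le rnorm_ge0 andbT.
exact: le0_eps h.
Qed.

Section contraction.
Variable B : bop H.
Hypotheses (sB : selfadjoint B) (B1 : forall x, rnorm (B x) <= rnorm x).

(* [Y = (B + Y^2) / 2] amounts to [(1 - Y)^2 = 1 - B]; the iterates are
   controlled in norm by those of the same recursion for the number 1. *)
Fixpoint sqrt_iter n : bop H :=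
  if n is m.+1 then 2^-1%:C *: (B + sqrt_iter m * sqrt_iter m) else 0.
Local Notation Y := sqrt_iter.

Lemma sqrt_iterS n x : Y n.+1 x = 2^-1%:C *: (B x + Y n (Y n x)).
Proof. by []. Qed.

Fixpoint sqrt_bound n : R :=
  if n is m.+1 then (1 + sqrt_bound m ^+ 2) / 2 else 0.
Local Notation y_ := sqrt_bound.

Lemma sqrt_bound_itv n : 0 <= y_ n <= 1.
Proof. by elim: n => [|n /andP[h0 h1]] /=; rewrite ?lexx ?ler01//; nra. Qed.

Lemma sqrt_bound_incr n : y_ n <= y_ n.+1.
Proof. by have /andP[] := sqrt_bound_itv n; rewrite /=; nra. Qed.

Lemma sqrt_iter_le n x : rnorm (Y n x) <= y_ n * rnorm x.
Proof.
elim: n x => [|n IH] x; first by rewrite /= mul0r rnorm0.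
rewrite sqrt_iterS [y_ _.+1]/= rnormZ rnormC ger0_norm ?invr_ge0//.
have /andP[h0 h1] := sqrt_bound_itv n.
rewrite mulrC mulrAC ler_wpM2r ?invr_ge0//.
rewrite (le_trans (rnormD _ _))// mulrDl mul1r lerD// (le_trans (IH _))//.
by rewrite expr2 -mulrA ler_wpM2l.
Qed.

Lemma sqrt_iter_sa n : selfadjoint (Y n).
Proof.
elim: n => [|n IH] x y; first by rewrite /= rip0l ripC rip0l.
by rewrite !sqrt_iterS ripZl ripZr ripDl ripDr sB !IH.
Qed.

(** Writing a^2 - b^2 as a (a - b) + (a - b) b, valid without commutation, bounds the two summands
    by scalar counterparts that add up exactly to the next increment of [y_]. *)
Lemma sqrt_iterS_dist n x :
  rnorm (Y n.+1 x - Y n x) <= (y_ n.+1 - y_ n) * rnorm x.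
Proof.
elim: n x => [|n IH] x.
  rewrite sqrt_iterS /= addr0 !subr0 rnormZ rnormC ger0_norm ?invr_ge0//.
  by rewrite expr0n addr0 mul1r ler_wpM2l ?invr_ge0.
have /andP[h0 h1] := sqrt_bound_itv n.
have /andP[k0 k1] := sqrt_bound_itv n.+1.
have -> : Y n.+2 x - Y n.+1 x =
    2^-1%:C *: (Y n.+1 (Y n.+1 x - Y n x) + (Y n.+1 (Y n x) - Y n (Y n x))).
  rewrite (sqrt_iterS n.+1) [X in _ - X = _]sqrt_iterS -scalerBr.
  rewrite opprD addrACA subrr add0r; congr (_ *: _).
  by rewrite bopB addrA subrK.
rewrite rnormZ rnormC ger0_norm ?invr_ge0//.
have := rnormD (Y n.+1 (Y n.+1 x - Y n x)) (Y n.+1 (Y n x) - Y n (Y n x)).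
have := sqrt_iter_le n.+1 (Y n.+1 x - Y n x).
have := ler_wpM2l k0 (IH x).
have := IH (Y n x).
have := sqrt_iter_le n x.
have := sqrt_bound_incr n.
rewrite [y_ n.+2]/=.
set a := rnorm (_ + _); set b := rnorm (Y n.+1 (_ - _)).
set c := rnorm (Y n.+1 (Y n x) - _); set d := rnorm (Y n x).
set e := rnorm (_ - _).
move=> h2 h3 h4 h5 h6 h7.
have h8 : c <= (y_ n.+1 - y_ n) * (y_ n * rnorm x).
  by rewrite (le_trans h4)// ler_wpM2l// subr_ge0.
rewrite /= in h2 h4 h5 h6 h7 h8 *; lra.
Qed.

Lemma sqrt_bound_le n k : y_ n <= y_ (k + n).
Proof. by elim: k => // k IH; rewrite (le_trans IH)// sqrt_bound_incr. Qed.

Lemma sqrt_iter_dist n k x :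
  rnorm (Y (k + n) x - Y n x) <= (y_ (k + n) - y_ n) * rnorm x.
Proof.
elim: k => [|k IH]; first by rewrite subrr rnorm0 subrr mul0r.
rewrite addSn -[Y _.+1 x](subrK (Y (k + n) x)) -addrA (le_trans (rnormD _ _))//.
by rewrite (le_trans (lerD (sqrt_iterS_dist _ _) IH))// -mulrDl addrA subrK.
Qed.

(** Tail of the bounded increasing scalar sequence; by telescoping it controls the distance from the
    n-th iterate to its limit. *)
Definition sqrt_gap n : R := sup (range y_) - y_ n.
Local Notation d_ := sqrt_gap.

Lemma has_sup_bound : has_sup (range y_).
Proof.
split; first by exists (y_ 0), 0%N.
by exists 1 => _ [n _ <-]; case/andP: (sqrt_bound_itv n).
Qed.

Lemma sqrt_gap_ge n k : y_ (k + n) - y_ n <= d_ n.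
Proof.
by rewrite lerD2r; apply: (sup_upper_bound has_sup_bound); exists (k + n)%N.
Qed.

Lemma sqrt_gap_small e : 0 < e -> exists n, d_ n < e.
Proof.
move=> e0; have [_ [n _ <-] h] := sup_adherent e0 has_sup_bound.
by exists n; rewrite /d_; lra.
Qed.

Lemma sqrt_iter_lim x :
  exists l, forall n, rnorm (Y n x - l) <= d_ n * rnorm x.
Proof.
have [|l hl] := @rnorm_cauchy _ _ (Y n x @[n --> \oo]) _.
  move=> e e0; have [|n dn] := @sqrt_gap_small (e / (rnorm x + 1)).
    by rewrite divr_gt0// ltr_wpDl ?rnorm_ge0.
  exists (Y n x); exists n => // m /= nm.
  rewrite -(subnK nm) (le_lt_trans (sqrt_iter_dist _ _ _))//.
  rewrite (@le_lt_trans _ _ (d_ n * (rnorm x + 1)))//.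
    have := rnorm_ge0 x; have := sqrt_gap_ge n (m - n).
    have := sqrt_bound_le n (m - n); nra.
  by rewrite -ltr_pdivlMr// ltr_wpDl ?rnorm_ge0.
exists l => n; apply/ler_addgt0Pr => e e0.
have [N _ hN] := hl e e0.
have := hN (N + n)%N (leq_addr _ _); rewrite /= => h.
have -> : Y n x - l = (Y (N + n) x - l) - (Y (N + n) x - Y n x).
  by rewrite opprB [RHS]addrC subrKA.
have := le_trans (sqrt_iter_dist n N x)
  (ler_wpM2r (rnorm_ge0 x) (sqrt_gap_ge n N)).
have := rnormD (Y (N + n) x - l) (- (Y (N + n) x - Y n x)).
rewrite rnormN; lra.
Qed.

(** The last equation says (1 - Q)^2 = 1 - B. [Q] is the pointwise limit of the iterates, with error
    at most [d_ n * rnorm x]. *)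
Lemma sqrt_contraction : exists Q : bop H, [/\ selfadjoint Q,
  forall x, rnorm (Q x) <= rnorm x & forall x, Q x + Q x = B x + Q (Q x)].
Proof.
have [f fY] := choice sqrt_iter_lim.
(* Limits are identified by their rate alone, which yields linearity of [f]. *)
have fE x z (K : R) : (forall n, rnorm (Y n x - z) <= d_ n * K) -> f x = z.
  move=> h; apply/eqP; rewrite -subr_eq0; apply/eqP.
  apply: (@rnorm_eps _ (rnorm x + `|K|)) => e e0.
  have [n dn] := sqrt_gap_small e0.
  have d0 : 0 <= d_ n by have := sqrt_gap_ge n 0; rewrite subrr.
  have -> : f x - z = (Y n x - z) - (Y n x - f x).
    by rewrite opprB [RHS]addrC subrKA.
  rewrite (le_trans (rnormD _ _))// rnormN.
  have := h n; have := fY x n; have := ler_norm K; have := rnorm_ge0 x.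
  have := normr_ge0 K; nra.
have lf : linear f.
  move=> a x y; apply: (fE _ _ (rnorm a * rnorm x + rnorm y)) => n.
  rewrite bopD bopZ opprD addrACA -scalerBr (le_trans (rnormD _ _))// mulrDr.
  by rewrite lerD// rnormZ mulrCA ler_wpM2l ?rnorm_ge0.
have f1 x : rnorm (f x) <= 1 * rnorm x.
  apply/ler_addgt0Pr => e e0.
  have [|n dn] := @sqrt_gap_small (e / (rnorm x + 1)).
    by rewrite divr_gt0// ltr_wpDl ?rnorm_ge0.
  have d0 : 0 <= d_ n by have := sqrt_gap_ge n 0; rewrite subrr.
  rewrite -[f x](subrK (Y n x)) (le_trans (rnormD _ _))// addrC lerD//.
    rewrite (le_trans (sqrt_iter_le _ _))// ler_wpM2r ?rnorm_ge0//.
    by case/andP: (sqrt_bound_itv n).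
  rewrite rnorm_distC (le_trans (fY x n))//.
  move: dn; rewrite ltr_pdivlMr ?ltr_wpDl ?rnorm_ge0// => dn; lra.
pose Q := Bop (is_bop_real lf f1); have QE x : Q x = f x by [].
exists Q; split => [x y|x|x]; last 2 first.
- by have := f1 x; rewrite mul1r.
- apply/eqP; rewrite -subr_eq0; apply/eqP.
  (* By 2 Y_(n+1) x = B x + Y_n (Y_n x), the defect splits into four errors of size at most d_n |x|:
     two from replacing Y_(n+1) x by f x, two from replacing Y_n (Y_n x) by f (f x). *)
  apply: (@rnorm_eps _ (4 * rnorm x)) => e e0.
  have [n dn] := sqrt_gap_small e0.
  have -> : Q x + Q x - (B x + Q (Q x)) =
      (f x - Y n.+1 x) + (f x - Y n.+1 x) +
      (Y n (Y n x - f x) + (Y n (f x) - f (f x))).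
    rewrite !QE bopB subrKA.
    have -> : Y n (Y n x) = Y n.+1 x + Y n.+1 x - B x.
      rewrite sqrt_iterS -scalerDl -rmorphD/=.
      have -> : 2^-1 + 2^-1 = 1 :> R by field.
      by rewrite scale1r addrC addKr.
    rewrite (addrACA (f x) (- _)) -opprD -(addrA (_ + _) (- B x)).
    by rewrite subrKA opprD.
  have d1 : d_ n.+1 <= d_ n by rewrite lerD2l lerN2 sqrt_bound_incr.
  have d0 : 0 <= d_ n by have := sqrt_gap_ge n 0; rewrite subrr.
  rewrite (le_trans (rnormD _ _))//.
  have := rnormD (f x - Y n.+1 x) (f x - Y n.+1 x).
  have := rnormD (Y n (Y n x - f x)) (Y n (f x) - f (f x)).
  have := fY x n.+1; rewrite (rnorm_distC _ (f x)).
  have := fY x n; have := fY (f x) n; have := f1 x; have := rnorm_ge0 x.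
  have := sqrt_iter_le n (Y n x - f x); have /andP[k0 k1] := sqrt_bound_itv n.
  have := rnorm_ge0 (Y n x - f x); have := rnorm_ge0 (f x).
  rewrite mul1r.
  set u := rnorm (f x - _); set v := rnorm (Y n x - _).
  set w := rnorm (_ - f (f x)).
  set s := rnorm (_ + _); set t := rnorm (_ + _); set p := rnorm (Y n _).
  set q := rnorm (f x); set r := rnorm x.
  move=> q0 v0 pv r0 qr wd vd ud tp su.
  have h1 : d_ n * q <= d_ n * r by rewrite ler_wpM2l.
  have h2 : y_ n * v <= v by rewrite ler_piMl.
  have h3 : d_ n.+1 * r <= d_ n * r by rewrite ler_wpM2r.
  have h4 : d_ n * r <= e * r by rewrite ler_wpM2r// ltW.
  lra.
apply/eqP; rewrite -subr_eq0 -normr_le0.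
apply: (@le0_eps _ _ (2 * rnorm x * rnorm y)) => e e0.
have [n dn] := sqrt_gap_small e0.
have -> : rip (Q x) y - rip x (Q y) =
    rip x (Y n y - f y) - rip (Y n x - f x) y.
  by rewrite !QE ripBl ripBr sqrt_iter_sa; ring.
rewrite (le_trans (ler_normB _ _))//.
have := ler_norm_rip x (Y n y - f y); have := ler_norm_rip (Y n x - f x) y.
have := ler_wpM2r (rnorm_ge0 y) (fY x n).
have := ler_wpM2l (rnorm_ge0 x) (fY y n).
have := ler_wpM2r (mulr_ge0 (rnorm_ge0 x) (rnorm_ge0 y)) (ltW dn).
lra.
Qed.
End contraction.

(** With a bound M of P, the operator B = 1 - P / M lies between 0 and 1, hence is a contraction.
    Then sqrt(M) (1 - Y) squares to M (1 - B) = P, and it is positive because |Y x| <= |x|. *)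
Lemma sqrt_exists P : positive_op P ->
  exists Q : bop H, positive_op Q /\ Q * Q = P.
Proof.
move=> pP; have [M M0 PM] := bop_bound P.
pose B : bop H := 1 - M^-1%:C *: P.
have BE x : B x = x - M^-1%:C *: P x by [].
have sB : selfadjoint B.
  by move=> x y; rewrite !BE !(ripBl, ripBr, ripZl, ripZr) (pos_selfadjoint pP).
have pB : positive_op B.
  apply/positive_opP; split => // x.
  rewrite BE ripBl ripZl ripxx subr_ge0 ler_pdivrMl// expr2 mulrA.
  by rewrite (le_trans (ler_rip _ _))// ler_wpM2r ?rnorm_ge0.
have B1 x : rnorm (B x) <= rnorm x.
  rewrite -[leRHS]mul1r; apply: pos_norm => // y.
  rewrite BE ripBl ripZl ripxx mul1r gerBl mulr_ge0 ?invr_ge0 ?(ltW M0)//.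
  exact: pos_ge0.
have [Y [sY Y1 YE]] := sqrt_contraction sB B1.
exists ((Num.sqrt M)%:C *: (1 - Y)); split.
  apply/positive_opP; split => [x y|x].
    by rewrite !bopE ripZl ripZr ripBl ripBr sY.
  rewrite !bopE ripZl mulr_ge0 ?sqrtr_ge0// ripBl ripxx subr_ge0.
  by rewrite (le_trans (ler_rip _ _))// expr2 ler_wpM2r ?rnorm_ge0.
apply: bop_ext => x; rewrite !bopE.
rewrite bopZ -scalerBr scalerA -rmorphM -expr2 sqr_sqrtr ?(ltW M0)//=.
rewrite bopB.
have -> : x - Y x - (Y x - Y (Y x)) = M^-1%:C *: P x.
  apply: (addIr (Y x + Y x)); rewrite opprB addrACA !subrK YE BE addrA.
  by rewrite [X in _ = X + _]addrC subrK.
by rewrite scalerA -rmorphM divff ?gt_eqF//= scale1r.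
Qed.

(** The representing vector is the minimizer of |x|^2 - 2 g x, by completing the square. *)
Lemma riesz (g : H -> R) (M : R) :
  (forall x y, g (x + y) = g x + g y) ->
  (forall (k : R) x, g (k%:C *: x) = k * g x) ->
  (forall x, `|g x| <= M * rnorm x) ->
  exists b, forall x, g x = rip x b.
Proof.
move=> gD gZ gM.
pose J x := rnorm x ^+ 2 - 2 * g x.
have JM x : - (M ^+ 2) <= J x.
  have := gM x; have := ler_norm (g x); have := sqr_ge0 (rnorm x - M).
  rewrite /J; lra.
have infJ : has_inf (range J).
  by split; [exists (J 0), 0 | exists (- (M ^+ 2)) => _ [x _ <-]].
pose d := inf (range J).
have dJ x : d <= J x by apply: (inf_lbound infJ.2); exists x.
pose F : set_system H := filter_from [set e : R | 0 < e]
  (fun e => [set x | J x < d + e]).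
have FF : ProperFilter F.
  apply: filter_from_proper; last first.
    by move=> e /= e0; have [_ [x _ <-] h] := inf_adherent e0 infJ; exists x.
  apply: filter_from_filter; first by exists 1 => /=.
  move=> e f /= e0 f0; exists (Num.min e f); first by rewrite /= lt_min e0.
  move=> x /= h; split; apply: (lt_le_trans h); rewrite lerD2l ge_min lexx//.
  by rewrite orbT.
(* Hence near-minimizers of [J] are close to each other. *)
have par x y : rnorm (x - y) ^+ 2 =
    2 * J x + 2 * J y - 4 * J (2^-1%:C *: (x + y)).
  rewrite /J gZ gD rnormZ rnormC ger0_norm ?invr_ge0// exprMn rnormB2 rnormD2.
  by field.
have [|l hl] := @rnorm_cauchy _ _ F FF.
  (* Both values of [J] are below d + e^2 / 4 and the midpoint value is at least d, so [par] gives
     |y - x|^2 < e^2. *)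
  move=> e e0; have e20 : 0 < e ^+ 2 / 4 by rewrite divr_gt0 ?exprn_gt0.
  have [_ [x _ <-] hx] := inf_adherent e20 infJ.
  exists x; exists (e ^+ 2 / 4) => //= y /= hy.
  rewrite -(@ltr_pXn2r _ 2)// ?nnegrE ?rnorm_ge0 ?(ltW e0)// par.
  have := dJ (2^-1%:C *: (y + x)); rewrite -/d in hx; lra.
exists l => z; apply/eqP; rewrite -subr_eq0 -normr_le0.
apply: (@le0_eps _ _ (2 * rnorm z)) => e e0.
have e20 : 0 < e ^+ 2 by rewrite exprn_gt0.
have : F ([set y | rnorm (y - l) < e] `&` [set x | J x < d + e ^+ 2]).
  by apply: filterI; [exact: hl | exists (e ^+ 2)].
move=> /filter_ex[x /= [xl Jx]].
(* Approximate Euler equation: J (x + t z) >= d > J x - e^2 makes e^2 + 2 t (rip x z - g z) + t^2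
   |z|^2 nonnegative for all t. *)
have h : (rip x z - g z) ^+ 2 <= e ^+ 2 * rnorm z ^+ 2.
  apply: discr_le => [|t]; first exact: sqr_ge0.
  have := dJ (x + t%:C *: z); move: Jx; rewrite /J gD gZ rnormD2 ripZr.
  by rewrite rnormZ rnormC exprMn real_normK ?num_real//; lra.
have {}h : `|rip x z - g z| <= e * rnorm z.
  rewrite -(@ler_pXn2r _ 2)// ?nnegrE ?mulr_ge0 ?rnorm_ge0 ?(ltW e0)//.
  by rewrite real_normK ?num_real// exprMn.
have -> : g z - rip z l = rip (x - l) z - (rip x z - g z).
  by rewrite ripBl (ripC l z); ring.
rewrite (le_trans (ler_normB _ _))//.
have := ler_norm_rip (x - l) z; have := ler_wpM2r (rnorm_ge0 z) (ltW xl); lra.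
Qed.

Lemma adjoint_exists A :
  exists B : bop H, forall x y, rip (A x) y = rip x (B y).
Proof.
have [M M0 AM] := bop_bound A.
have [f fA] : {f : H -> H & forall y x, rip (A x) y = rip x (f y)}.
  apply: (@choice _ _ (fun y b => forall x, rip (A x) y = rip x b)) => y.
  apply: (@riesz _ (M * rnorm y)) => [x z|k x|x].
  - by rewrite bopD ripDl.
  - by rewrite bopZ ripZl.
  - rewrite (le_trans (ler_norm_rip _ _))// mulrAC ler_wpM2r ?rnorm_ge0//.
have lf : linear f.
  move=> a x y; apply: rip_ext => z; rewrite ripC -fA ripDr.
  have -> : rip (A z) (a *: x) = rip (A (Num.conj a *: z)) x.
    by rewrite bopZ /rip innerZl innerZr.
  rewrite !fA ripDl; congr (_ + _); last exact: ripC.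
  by rewrite [RHS]ripC /rip innerZl innerZr.
have f1 y : rnorm (f y) <= M * rnorm y.
  have [f0|f0] := eqVneq (rnorm (f y)) 0.
    by rewrite f0 mulr_ge0 ?rnorm_ge0 ?ltW.
  have fp : 0 < rnorm (f y) by rewrite lt_def f0 rnorm_ge0.
  rewrite -(ler_pM2r fp) -expr2 -ripxx -fA (le_trans (ler_rip _ _))//.
  by rewrite mulrAC ler_wpM2r ?rnorm_ge0.
by exists (Bop (is_bop_real lf f1)) => x y; exact: fA.
Qed.

Lemma adjoint_inner A x y : '[A x, y] = '[x, adjoint A y].
Proof.
have [B hB] := adjoint_exists A; move: x y.
apply: (@xgetPex _ 0 [set B : bop H | forall x y, '[A x, y] = '[x, B y]]).
by exists B => x y /=; rewrite !innerE !hB bopZ.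
Qed.

Lemma adjointE A x y : rip (A x) y = rip x (adjoint A y).
Proof. by rewrite /rip adjoint_inner. Qed.

Lemma adjoint_bound A (M : R) : 0 <= M ->
  (forall x, rnorm (A x) <= M * rnorm x) ->
  forall x, rnorm (adjoint A x) <= M * rnorm x.
Proof.
move=> M0 AM x; set y := adjoint A x.
have [y0|y0] := eqVneq (rnorm y) 0; first by rewrite y0 mulr_ge0 ?rnorm_ge0.
have yp : 0 < rnorm y by rewrite lt_def y0 rnorm_ge0.
rewrite -(ler_pM2r yp) -expr2 -ripxx -adjointE (le_trans (ler_rip _ _))//.
by rewrite mulrAC ler_wpM2r ?rnorm_ge0.
Qed.

Lemma selfadjoint_inner A x y : selfadjoint A -> '[A x, y] = '[x, A y].
Proof. by move=> sA; rewrite !innerE -bopZ !sA. Qed.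

Lemma sqrt_opP P : positive_op P ->
  positive_op (sqrt_op P) /\ sqrt_op P * sqrt_op P = P.
Proof.
move=> /sqrt_exists pP.
exact: (@xgetPex _ 0 [set Q : bop H | positive_op Q /\ Q * Q = P]).
Qed.

Lemma abs_opP Z : positive_op (abs_op Z) /\
  forall x, rnorm (abs_op Z x) = rnorm (Z x).
Proof.
have [|p q] := @sqrt_opP (adjoint Z * Z).
  apply/positive_opP; split => [x y|x].
    by rewrite !bopE -adjointE ripC -adjointE ripC.
  by rewrite bopE ripC -adjointE ripxx sqr_ge0.
split => // x; apply/eqP; rewrite -(@eqrXn2 _ 2) ?rnorm_ge0//.
by rewrite -!ripxx /abs_op pos_selfadjoint// -bopE_mul q bopE -adjointE.
Qed.

(** [P] and [abs_op P] are positive with equal norms on every vector, so each dominates the other.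
    Trace norms of positive operators thereby become plain sums of diagonal entries. *)
Lemma abs_op_pos P : positive_op P -> abs_op P = P.
Proof.
move=> pP; have [p q] := abs_opP P.
have pD : positive_op (P - abs_op P).
  apply/positive_opP; split => [x y|x].
    by rewrite !bopE ripBl ripBr !pos_selfadjoint.
  rewrite !bopE ripBl subr_ge0; apply: selfadjoint_le_of_norm => //.
    exact: pos_selfadjoint.
  by move=> y; rewrite q.
apply/esym/eqP; rewrite -subr_eq0; apply/eqP/bop_ext => x.
apply: rnorm0_eq0; apply/eqP; rewrite eq_le rnorm_ge0 andbT.
(* A positive operator whose form is at most 0 vanishes: [pos_norm] with constant 0. *)
rewrite -[leRHS](mul0r (rnorm x)); apply: pos_norm => // y.
rewrite mul0r !bopE ripBl subr_le0; apply: selfadjoint_le_of_norm => //.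
    exact: pos_selfadjoint.
by move=> u; rewrite q.
Qed.

Lemma ler_norm_abs_op Z x : selfadjoint Z ->
  `|rip (Z x) x| <= rip (abs_op Z x) x.
Proof.
move=> sZ; have [p q] := abs_opP Z.
rewrite ler_norml lerNl -ripNl; apply/andP; split.
  apply: (@selfadjoint_le_of_norm _ _ _ (- Z)) => // [u v|u].
    by rewrite !bopE ripNl ripNr sZ.
  by rewrite bopE rnormN q.
by apply: selfadjoint_le_of_norm => // u; rewrite q.
Qed.

End sqrt.

(** * Parseval's identity *)

Section basis.
Context {R : realType} {H : hilbertType R}.
Implicit Types (x y z : H) (A P Q Z : bop H) (s : seq H).

Definition finite_sub (S : set H) s := uniq s /\ {in s, forall e, S e}.

Lemma esum_leP (S : set H) (a : H -> R) (M : R) :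
  (\esum_(e in S) (a e)%:E <= M%:E)%E <->
  forall s, finite_sub S s -> \sum_(e <- s) a e <= M.
Proof.
split=> [h s [us sS]|h].
  rewrite -lee_fin -sumEFin; apply: le_trans h; apply: esum_ge.
  exists [set` s]; first by split; [exact: finite_seq | move=> e /= /sS].
  by rewrite -fsbig_seq.
apply: ge_ereal_sup => _ [F [fF FS] <-]; rewrite fsbig_finite//=.
rewrite sumEFin lee_fin.
apply: h; split; first exact: fset_uniq.
by move=> e; rewrite in_fset_set// => /set_mem /FS.
Qed.

Section parseval.
Variable S : set H.
Hypothesis oS : orthonormal_basis S.

Definition proj s x : H := \sum_(e <- s) '[x, e] *: e.

Lemma proj_inner s x f : finite_sub S s -> f \in s ->
  '[x - proj s x, f] = 0.
Proof.
move=> [us sS] fs; rewrite linearBl/= /proj linear_sumlz (bigD1_seq f)//=.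
rewrite innerZl (oS.1 _ _ (sS f fs) (sS f fs)) eqxx mulr1 big1_seq; last first.
  move=> e /andP[ef es]; rewrite innerZl (oS.1 _ _ (sS e es) (sS f fs)).
  by rewrite (negbTE ef) mulr0.
by rewrite addr0 subrr.
Qed.

Lemma proj_orth s x (c : H -> R[i]) : finite_sub S s ->
  '[x - proj s x, \sum_(e <- s) c e *: e] = 0.
Proof.
move=> fs; rewrite linear_sumr big1_seq// => e /andP[_ es].
by rewrite /= innerZr proj_inner// mulr0.
Qed.

Lemma proj_dist s x : finite_sub S s ->
  rnorm (x - proj s x) ^+ 2 = rnorm x ^+ 2 - \sum_(e <- s) rnorm '[x, e] ^+ 2.
Proof.
move=> fs; have h := proj_orth x (fun e => '[x, e]) fs.
rewrite -{1}ripxx ripBr [X in _ - X]/rip h subr0 ripBl ripxx; congr (_ - _).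
rewrite /rip /proj linear_sumlz.
apply: complexI; rewrite rmorph_sum/= RRe_real; last first.
  apply: rpred_sum => e _; rewrite innerZl (innerC x e) -normCK.
  by rewrite rpredX// normr_real.
by apply: eq_bigr => e _; rewrite innerZl (innerC x e) -normCK rnormE rmorphXn.
Qed.

Lemma bessel s x : finite_sub S s ->
  \sum_(e <- s) rnorm '[x, e] ^+ 2 <= rnorm x ^+ 2.
Proof. by move=> /(proj_dist x) h; rewrite -subr_ge0 -h sqr_ge0. Qed.

Lemma proj_nearest s x (c : H -> R[i]) : finite_sub S s ->
  rnorm (x - proj s x) <= rnorm (x - \sum_(e <- s) c e *: e).
Proof.
move=> fs.
rewrite -(@ler_pXn2r _ 2)// ?nnegrE ?rnorm_ge0//.
have -> : x - \sum_(e <- s) c e *: e =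
    (x - proj s x) + \sum_(e <- s) ('[x, e] - c e) *: e.
  rewrite -[LHS](subrKA (proj s x)); congr (_ + _).
  by rewrite /proj -sumrB; apply: eq_bigr => e _; rewrite scalerBl.
by rewrite [leRHS]rnormD2 /rip proj_orth//= mulr0 addr0 lerDl sqr_ge0.
Qed.

(** [lin_span] allows repeated vectors while [finite_sub] does not, so coefficients of equal vectors
    are added up. *)
Lemma lin_span_seq x : lin_span S x ->
  exists s (c : H -> R[i]), finite_sub S s /\ x = \sum_(e <- s) c e *: e.
Proof.
move=> [n [c [v [vS ->]]]].
pose s := undup [seq v i | i <- enum 'I_n].
exists s, (fun e => \sum_(i < n | v i == e) c i); split.
  split; first exact: undup_uniq.
  by move=> e; rewrite mem_undup => /mapP[i _ ->].
rewrite (eq_bigr (fun e => \sum_(i < n | v i == e) c i *: v i)); last first.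
  by move=> e _; rewrite scaler_suml; apply: eq_bigr => i /eqP->.
rewrite (exchange_big_dep xpredT)//=; apply: eq_bigr => i _.
rewrite big_const_seq (_ : count _ _ = 1%N) /= ?addr0//.
rewrite (eq_count (a2 := pred1 (v i))); last by move=> e /=; rewrite eq_sym.
by rewrite count_uniq_mem ?undup_uniq// mem_undup map_f// mem_enum.
Qed.

(** Bessel gives one inequality. For the other, totality supplies a finite combination within
    sqrt(e) of [x]; the projection is at least as close, and [proj_dist] computes its distance. *)
Lemma parseval x :
  (\esum_(e in S) (rnorm '[x, e] ^+ 2)%:E)%E = (rnorm x ^+ 2)%:E.
Proof.
apply/eqP; rewrite eq_le; apply/andP; split.
  by apply/esum_leP => s; exact: bessel.
apply/lee_addgt0Pr => e e0.
pose d := Num.sqrt e; have d0 : 0 < d by rewrite sqrtr_gt0.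
have : closure (lin_span S) x by rewrite oS.2.
have nx : nbhs x (ball x d%:C) by apply: nbhsx_ballx; rewrite ltcR.
move=> /(_ _ nx)[y [/lin_span_seq[s [c [fs ->]]]]].
rewrite -ball_normE /= rnormE ltcR => h.
have h2 : rnorm (x - proj s x) ^+ 2 <= e.
  rewrite -(sqr_sqrtr (ltW e0)) -/d ler_pXn2r// ?nnegrE ?rnorm_ge0 ?(ltW d0)//.
  by rewrite (le_trans (proj_nearest x c fs))// ltW.
rewrite proj_dist// in h2.
apply: (@le_trans _ _ ((\sum_(e <- s) rnorm '[x, e] ^+ 2)%:E + e%:E)%E).
  by rewrite -EFinD lee_fin; lra.
rewrite leeD2r// -sumEFin; apply: esum_ge.
exists [set` s]; last by rewrite -fsbig_seq//; case: fs.
by split; [exact: finite_seq | case: fs => _ + e' /= => /[apply]].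
Qed.

Definition trace_le P (t : R) :=
  forall s, finite_sub S s -> \sum_(e <- s) rip (P e) e <= t.

(* With [Q = sqrt P], this is the Hilbert-Schmidt bound [|Q A| = |A^* Q| <=
   M |Q|], obtained by exchanging the sums over two copies of the basis. *)
Lemma trace_le_conj P A (M t : R) : positive_op P -> 0 <= M ->
  (forall x, rnorm (A x) <= M * rnorm x) -> trace_le P t ->
  forall s, finite_sub S s -> \sum_(e <- s) rip (P (A e)) (A e) <= M ^+ 2 * t.
Proof.
move=> pP M0 AM Pt s fs.
have [pQ QQ] := sqrt_opP pP; set Q := sqrt_op P in pQ QQ.
have QE x : rip (P x) x = rnorm (Q x) ^+ 2.
  by rewrite -QQ bopE (pos_selfadjoint pQ) ripxx.
rewrite -lee_fin -sumEFin.
under eq_bigr do rewrite QE -parseval.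
rewrite -esum_sum; last by move=> *; rewrite lee_fin sqr_ge0.
apply: (@le_trans _ _ (\esum_(f in S) (M ^+ 2 * rip (P f) f)%:E)%E).
  apply: le_esum => f _; rewrite sumEFin lee_fin QE.
  (* Moving [Q] and [A] to the other side makes the sum over [e] a Bessel sum for the single vector
     A^* Q f. *)
  have -> : \sum_(e <- s) rnorm '[Q (A e), f] ^+ 2 =
      \sum_(e <- s) rnorm '[adjoint A (Q f), e] ^+ 2.
    apply: eq_bigr => e _.
    rewrite (selfadjoint_inner _ _ (pos_selfadjoint pQ)) adjoint_inner.
    by rewrite innerC rnorm_conj.
  rewrite (le_trans (bessel _ fs))//.
  rewrite -exprMn ler_pXn2r ?nnegrE ?mulr_ge0 ?rnorm_ge0//.
  exact: adjoint_bound.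
apply/esum_leP => r fr; rewrite -mulr_sumr ler_wpM2l ?sqr_ge0//.
exact: Pt.
Qed.

End parseval.
End basis.

(** * Unordered sums *)

Local Existing Instance summability.totally_filter.

Section has_sum.
Context {R : realType} {I : choiceType}.
Implicit Types (f g : I -> R[i]) (l : R[i]).

Definition has_sum f l := forall e : R, 0 < e ->
  summability.totally
    [set F : {fset I} | rnorm (summability.partial_sum f F - l) < e].

Lemma has_sum_eq f l : has_sum f l ->
  summability.sum (f : I -> R[i]^o) = l.
Proof.
move=> h; apply: (@cvg_lim R[i]^o); first exact: norm_hausdorff.
apply/cvgrPdist_lt => e e0.
have re : e = (complex.Re e)%:C by rewrite RRe_real// gtr0_real.
have /h : 0 < complex.Re e by rewrite -ltcR -re.
by apply: filterS => F /=; rewrite re distrC rnormE ltcR.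
Qed.

Lemma has_sumDZ f g a b l m : has_sum f l -> has_sum g m ->
  has_sum (fun i => a * f i + b * g i) (a * l + b * m).
Proof.
move=> hf hg e e0; pose K := rnorm a + rnorm b + 1.
have K0 : 0 < K by rewrite ltr_wpDl// addr_ge0 ?rnorm_ge0.
have eK : 0 < e / K by rewrite divr_gt0.
apply: filterS (filterI (hf _ eK) (hg _ eK)) => F /= [].
set x := summability.partial_sum f F; set y := summability.partial_sum g F.
have -> : summability.partial_sum (fun i => a * f i + b * g i) F =
    a * x + b * y.
  by rewrite /summability.partial_sum big_split/= -!mulr_sumr.
have -> : a * x + b * y - (a * l + b * m) = a * (x - l) + b * (y - m) by ring.
move=> h1 h2; rewrite (le_lt_trans (rnormD _ _))//.
have rM (u v : R[i]) : rnorm (u * v) = rnorm u * rnorm v :=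
  @rnormZ _ R[i]^o u v.
rewrite !rM; have e1 : e = K * (e / K) by field; rewrite gt_eqF.
rewrite [ltRHS]e1 /K; have := rnorm_ge0 a; have := rnorm_ge0 b; nra.
Qed.

Lemma has_sum_bound f l (M : R) : has_sum f l ->
  (forall F : {fset I}, \sum_(i : F) rnorm (f (val i)) <= M) -> rnorm l <= M.
Proof.
move=> h hM; apply/ler_addgt0Pr => e e0.
have /filter_ex[F /= hF] := h e e0.
have -> : l = summability.partial_sum f F - (summability.partial_sum f F - l).
  by rewrite subKr.
rewrite (le_trans (rnormD _ _))// rnormN; apply: lerD (ltW hF).
apply: le_trans (hM F); rewrite /summability.partial_sum.
elim/big_rec2 : _ => [|i u v _ h']; first by rewrite rnorm0.
by rewrite (le_trans (rnormD _ _))// lerD2l.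
Qed.

(* Completeness of the scalars [R[i]] is inherited from the line spanned by a
   unit vector [v] of the complete space [V]. *)
Lemma has_sum_exists (H : hilbertType R) (v : H) f (M : R) : '[v, v] = 1 ->
  (forall F : {fset I}, \sum_(i : F) rnorm (f (val i)) <= M) ->
  exists l, has_sum f l.
Proof.
move=> v1 hM.
have v1' : rnorm v = 1.
  apply/eqP; rewrite -(@eqrXn2 _ 2) ?rnorm_ge0// expr1n -ripxx /rip v1.
  by [].
pose S := range (fun F : {fset I} => \sum_(i : F) rnorm (f (val i))).
have supS : has_sup S.
  by split; [by eexists; exists fset0 | exists M => _ [F _ <-]].
pose G : set_system H :=
  summability.partial_sum f F *: v @[F --> summability.totally].
have [|l hl] := @rnorm_cauchy _ _ G _.
  move=> e e0; have [_ [F _ <-] hF] := sup_adherent e0 supS.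
  exists (summability.partial_sum f F *: v); exists F => // E /= FE.
  rewrite -scalerBl rnormZ v1' mulr1.
  have h : rnorm (summability.partial_sum f E - summability.partial_sum f F) <=
      \sum_(i : E) rnorm (f (val i)) - \sum_(i : F) rnorm (f (val i)).
    rewrite /summability.partial_sum.
    rewrite -!(big_seq_fsetE _ _ xpredT f)/=.
    rewrite -!(big_seq_fsetE _ _ xpredT (fun i => rnorm (f i)))/=.
    have split_sum (W : nmodType) (g : I -> W) : \sum_(i <- E) g i =
        \sum_(i <- F) g i + \sum_(i <- (E `\` F)%fset) g i.
      rewrite (big_fsetID _ (mem F))/=; congr (_ + _); apply: eq_fbigl => i.
        by rewrite !inE andbC; case: (boolP (i \in F)) => // /(fsubsetP FE) ->.
      by rewrite !inE andbC.
    rewrite !split_sum ![\sum_(i <- F) _ + _]addrC !addrK.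
    elim/big_rec2 : _ => [|i u w _ h']; first by rewrite rnorm0.
    by rewrite (le_trans (rnormD _ _))// lerD2l.
  have : \sum_(i : E) rnorm (f (val i)) <= sup S.
    by apply: (sup_upper_bound supS); exists E.
  lra.
exists '[l, v] => e e0.
apply: filterS (hl _ e0 : summability.totally _) => F /= h.
have -> : summability.partial_sum f F - '[l, v] =
    '[summability.partial_sum f F *: v - l, v].
  by rewrite linearBl /= innerZl v1 mulr1.
by rewrite (le_lt_trans (ler_rnorm_inner _ _))// v1' mulr1.
Qed.

End has_sum.

(** * Trace norm estimates *)

Section trace.
Context {R : realType} {H : hilbertType R}.
Implicit Types (x y z : H) (A P Q Z X Y : bop H) (s : seq H).
Local Notation S := (@hbasis R H).

(** Cauchy-Schwarz and a b <= (a + b)^2. The sum in place of the geometric mean lets the bound be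
    summed over a basis as two traces. *)
Lemma pos_inner_le P x y : positive_op P ->
  rnorm '[P x, y] <= rip (P x) x + rip (P y) y.
Proof.
move=> pP; have a0 := pos_ge0 pP x; have b0 := pos_ge0 pP y.
rewrite -(@ler_pXn2r _ 2)// ?nnegrE ?rnorm_ge0 ?addr_ge0//.
apply: (@le_trans _ _ (rip (P x) x * rip (P y) y)); last by nra.
have [u uu ->] := phase '[P x, y]; rewrite -innerZl -bopZ.
rewrite (le_trans (pos_CauchySchwarz pP _ _))// bopZ.
rewrite [X in X * _](_ : _ = rip (P x) x)//.
by rewrite /rip innerZl innerZr mulrA uu mul1r.
Qed.

Hypothesis oS : orthonormal_basis S.

Lemma trace_normP Z t : (trace_norm Z <= t%:E)%E <-> trace_le S (abs_op Z) t.
Proof. exact: esum_leP. Qed.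

Lemma trace_classP Z : trace_class Z -> exists t, trace_le S (abs_op Z) t.
Proof.
move=> h; exists (fine (trace_norm Z)); apply/trace_normP.
rewrite fineK ?ge0_fin_numE//; apply: esum_ge0 => e _.
by rewrite lee_fin; exact: (pos_ge0 (abs_opP Z).1).
Qed.

Section bound.
Variables (v : H) (Sv : S v).

Lemma basis_unit : '[v, v] = 1.
Proof. by rewrite oS.1// eqxx. Qed.

Lemma trace_le_ge0 P t : positive_op P -> trace_le S P t -> 0 <= t.
Proof. by move=> pP /(_ [::]); rewrite big_nil; apply; split. Qed.

(* [trace_le_conj] for the operator of rank one mapping [v] to [x]. *)
Lemma trace_le_form P t x : positive_op P -> trace_le S P t ->
  rip (P x) x <= t * rnorm x ^+ 2.
Proof.
move=> pP Pt.
have v1 : rnorm v = 1.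
  apply/eqP; rewrite -(@eqrXn2 _ 2) ?rnorm_ge0// expr1n -ripxx /rip basis_unit.
  by [].
have lf : linear (fun y => '[y, v] *: x).
  by move=> a y z; rewrite linearDl /= innerZl scalerDl scalerA.
have f1 y : rnorm ('[y, v] *: x) <= rnorm x * rnorm y.
  rewrite rnormZ mulrC ler_wpM2l ?rnorm_ge0//.
  by rewrite (le_trans (ler_rnorm_inner _ _))// v1 mulr1.
have := @trace_le_conj _ _ S oS P (Bop (is_bop_real lf f1)) (rnorm x) t pP
  (rnorm_ge0 x) f1 Pt [:: v].
rewrite big_seq1 /= basis_unit scale1r mulrC; apply; split => // e.
by rewrite inE => /eqP->.
Qed.

Lemma trace_norm_bound Z t x : (trace_norm Z <= t%:E)%E ->
  rnorm (Z x) <= t * rnorm x.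
Proof.
move=> /trace_normP Zt; have [pP PZ] := abs_opP Z.
rewrite -PZ; apply: (pos_norm pP); last exact: trace_le_ge0 Zt.
by move=> y; exact: trace_le_form.
Qed.

(* [Z = |Z| - (|Z| - Z)] is a difference of positive operators of trace at most
   [t] and [2 t]. *)
Lemma trace_sum_bound Z A (M t : R) s : selfadjoint Z -> 0 <= M ->
  (forall x, rnorm (A x) <= M * rnorm x) -> (trace_norm Z <= t%:E)%E ->
  finite_sub S s ->
  \sum_(e <- s) rnorm '[(Z * A) e, e] <= 3 * (M ^+ 2 + 1) * t.
Proof.
move=> sZ M0 AM /trace_normP Zt fs; have [pP PZ] := abs_opP Z.
set P := abs_op Z in pP PZ Zt.
(* The term M^2 u comes from the conjugated trace, u from the plain one; using this for [P] with t
   and for [N] with 2 t gives the factor 3. *)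
have hP Q u : positive_op Q -> trace_le S Q u ->
    \sum_(e <- s) rnorm '[Q (A e), e] <= (M ^+ 2 + 1) * u.
  move=> pQ Qu; rewrite mulrDl mul1r.
  rewrite (le_trans _ (lerD (trace_le_conj oS pQ M0 AM Qu fs) (Qu s fs)))//.
  by rewrite -big_split/= ler_sum// => e _; exact: pos_inner_le.
pose N := P - Z.
have pN : positive_op N.
  apply/positive_opP; split => [x y|x].
    by rewrite !bopE ripBl ripBr (pos_selfadjoint pP) sZ.
  rewrite !bopE ripBl subr_ge0 (le_trans (ler_norm _))//.
  exact: ler_norm_abs_op.
have Nt : trace_le S N (2 * t).
  move=> r fr; apply: le_trans (ler_wpM2l (ler0n _ 2) (Zt r fr)).
  rewrite mulr_sumr; apply: ler_sum => e _; rewrite !bopE ripBl.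
  have := ler_norm_abs_op e sZ; rewrite ler_norml => /andP[+ _].
  by rewrite -/P; lra.
have := lerD (hP _ _ pP Zt) (hP _ _ pN Nt); rewrite -big_split/=.
have -> : (M ^+ 2 + 1) * t + (M ^+ 2 + 1) * (2 * t) =
    3 * (M ^+ 2 + 1) * t by ring.
apply: le_trans; apply: ler_sum => e _.
have -> : '[(Z * A) e, e] = '[P (A e), e] - '[N (A e), e].
  by rewrite !bopE linearBl subKr.
by rewrite (le_trans (rnormD _ _))// rnormN.
Qed.

Definition diag A (e : S) : R[i] := '[A (val e), val e].

Lemma diag_has_sum Z A (M t : R) : selfadjoint Z -> 0 <= M ->
  (forall x, rnorm (A x) <= M * rnorm x) -> (trace_norm Z <= t%:E)%E ->
  has_sum (diag (Z * A)) (tr (Z * A)) /\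
  rnorm (tr (Z * A)) <= 3 * (M ^+ 2 + 1) * t.
Proof.
move=> sZ M0 AM Zt.
have h (F : {fset S}) :
    \sum_(i : F) rnorm (diag (Z * A) (val i)) <= 3 * (M ^+ 2 + 1) * t.
  rewrite -(big_seq_fsetE _ _ xpredT (fun i => rnorm (diag (Z * A) i)))/=.
  rewrite -(big_map val xpredT (fun e => rnorm '[(Z * A) e, e])).
  apply: trace_sum_bound => //; split.
    by rewrite map_inj_uniq ?fset_uniq//; exact: val_inj.
  by move=> e /mapP[i _ ->]; exact: set_valP.
have [l hl] := has_sum_exists basis_unit h.
have -> : tr (Z * A) = l by exact: has_sum_eq.
by split => //; exact: has_sum_bound h.
Qed.

End bound.
End trace.

(** * Density operators *)

Section density.
Context {R : realType} {H : hilbertType R}.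
Implicit Types (x y z : H) (A P Q Z X Y rho sigma : bop H).
Local Notation S := (@hbasis R H).

(* When no orthonormal basis is available, [hbasis H] is the dummy [set0] and
   every trace is an empty sum. *)
Lemma tr_neq0_basis A : tr A != 0 -> orthonormal_basis S /\ S !=set0.
Proof.
move=> tA; have S0 : S !=set0.
  apply/set0P; apply: contra_neq tA => S0.
  apply: has_sum_eq => e e0; exists fset0 => // F _ /=.
  rewrite /summability.partial_sum big1 ?subrr ?rnorm0// => i _; exfalso.
  have Ssub0 : S `<=` set0 by rewrite S0.
  exact: Ssub0 (set_valP (val i)).
split => //.
have [[B oB]|nB] := pselect (exists B : set H, orthonormal_basis B).
  by apply: (@xgetPex _ set0 [set B | orthonormal_basis B]); exists B.
move: S0; rewrite /hbasis xgetPN; first by case.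
by move=> B oB; apply: nB; exists B.
Qed.

Hypotheses (oS : orthonormal_basis S) (v : H) (Sv : S v).

Lemma density_trace_le rho : positive_op rho -> trace_class rho ->
  exists t, trace_le S rho t.
Proof. by move=> p /trace_classP; rewrite abs_op_pos. Qed.

Lemma pos_has_sum rho A : positive_op rho -> trace_class rho ->
  has_sum (diag (rho * A)) (tr (rho * A)).
Proof.
move=> pr tr_r; have [t ht] := density_trace_le pr tr_r.
have [M M0 AM] := bop_bound A.
have rho_t : (trace_norm rho <= t%:E)%E.
  by apply/trace_normP; rewrite abs_op_pos.
exact: (diag_has_sum oS Sv (pos_selfadjoint pr) (ltW M0) AM rho_t).1.
Qed.

Lemma tr_comb rho sigma A (a b : R[i]) :
  positive_op rho -> trace_class rho ->
  positive_op sigma -> trace_class sigma ->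
  tr ((a *: rho + b *: sigma) * A) = a * tr (rho * A) + b * tr (sigma * A).
Proof.
move=> pr tr_r ps tr_s; apply: has_sum_eq.
have := has_sumDZ a b (pos_has_sum A pr tr_r) (pos_has_sum A ps tr_s).
congr (has_sum _ _); apply: funext => e.
by rewrite /diag !bopE linearDl /= !innerZl.
Qed.

Lemma density_comb rho sigma (a b : R[i]) : 0 <= a -> 0 <= b -> a + b = 1 ->
  density rho -> density sigma -> density (a *: rho + b *: sigma).
Proof.
move=> a0 b0 ab [pr tr_r r1] [ps tr_s s1].
have pc : positive_op (a *: rho + b *: sigma).
  by move=> x; rewrite !bopE linearDl /= !innerZl addr_ge0// mulr_ge0.
split => //.
  have [t ht] := density_trace_le pr tr_r.
  have [u hu] := density_trace_le ps tr_s.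
  (* The combination is positive, so its trace norm is a sum of diagonal entries, which is linear in
     the two operators. *)
  apply: (@le_lt_trans _ _ (complex.Re a * t + complex.Re b * u)%:E);
    last exact: ltry.
  apply/trace_normP; rewrite abs_op_pos// => s fs.
  have reE (c : R[i]) : 0 <= c -> c = (complex.Re c)%:C.
    by move=> c0; rewrite RRe_real// ger0_real.
  have ripE e : rip ((a *: rho + b *: sigma) e) e =
      complex.Re a * rip (rho e) e + complex.Re b * rip (sigma e) e.
    by rewrite !bopE ripDl {1}(reE a a0) {1}(reE b b0) !ripZl.
  under eq_bigr do rewrite ripE.
  rewrite big_split/= -!mulr_sumr lerD// ler_wpM2l -?ler0c -?reE//.
    exact: ht.
  exact: hu.
by rewrite -[_ + _]mulr1 tr_comb// !mulr1 r1 s1 !mulr1.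
Qed.

(** [K] depends on [A] alone, so it is fixed before an approximant [Y] is chosen for each [e]. *)
Lemma tr_dist A : exists K : R, forall X Y (e : R),
  positive_op X -> trace_class X -> positive_op Y -> trace_class Y ->
  (trace_norm (X - Y)%R < e%:E)%E ->
  rnorm (tr (X * A) - tr (Y * A)) <= e * K.
Proof.
have [M M0 AM] := bop_bound A.
exists (3 * (M ^+ 2 + 1)) => X Y e pX tX pY tY XY.
have sXY : selfadjoint (X - Y).
  by move=> x y; rewrite !bopE ripBl ripBr !pos_selfadjoint.
have [_] := diag_has_sum oS Sv sXY (ltW M0) AM (ltW XY).
rewrite -[X in X - Y]scale1r -scaleN1r tr_comb//.
by rewrite mul1r mulN1r mulrC.
Qed.

(** The symmetry defect of [X] equals that of [X - Y], and <X x, x> >= <(X - Y) x, x>; both are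
    controlled by the trace norm of [X - Y]. *)
Lemma limit_positive (C : set (bop H)) X : C `<=` positive_op ->
  (forall e : R, 0 < e -> exists2 Y, C Y & (trace_norm (X - Y)%R < e%:E)%E) ->
  positive_op X.
Proof.
move=> Cpos CX; apply/positive_opP; split => [x y|x].
  apply/eqP; rewrite -subr_eq0 -normr_le0.
  apply: (@le0_eps _ _ (2 * rnorm x * rnorm y)) => e /CX[Y /Cpos pY /ltW XY].
  have -> : rip (X x) y - rip x (X y) =
      rip ((X - Y) x) y - rip x ((X - Y) y).
    by rewrite !bopE ripBl ripBr (pos_selfadjoint pY); ring.
  rewrite (le_trans (ler_normB _ _))//.
  have := ler_norm_rip ((X - Y) x) y; have := ler_norm_rip x ((X - Y) y).
  have := ler_wpM2r (rnorm_ge0 y) (trace_norm_bound oS Sv x XY).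
  have := ler_wpM2l (rnorm_ge0 x) (trace_norm_bound oS Sv y XY).
  lra.
rewrite -oppr_le0; apply: (@le0_eps _ _ (rnorm x ^+ 2)) => e.
move=> /CX[Y /Cpos pY /ltW XY].
have := ler_wpM2r (rnorm_ge0 x) (trace_norm_bound oS Sv x XY).
have := ler_norm_rip ((X - Y) x) x; rewrite !bopE ripBl ler_norml => /andP[+ _].
have := pos_ge0 pY x; lra.
Qed.

End density.

Theorem proposition4 (R : realType) (H h G K : hilbertType R)
    (q : statistics) (iota : forall n, ('I_n -> h) -> G)
    (tens : {bilinear H -> G -> K}) (Psi : bop G)
    (U : R -> bop K) (E : bop K -> bop H) (T : R -> {linear bop H -> bop H})
    (hG : fock_space q iota)
    (hK : hilbert_tensor tens)
    (hPsi : density Psi)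
    (hE : conditional_expectation tens Psi E)
    (hU : forall t : R, 0 <= t -> unitary (U t))
    (hT : qds T)
    (hTU : forall (t : R) (X : bop H), 0 <= t ->
       T t X = E (adjoint (U t) * tensor_op tens X 1 * U t))
    (hcont : norm_continuous_family T)
    (hne : invariant_density T !=set0) :
  @convex_set R[i] (bop H) (invariant_density T) /\
  trace_norm_closed (invariant_density T).
Proof.
have [rho0 [[_ _ tr0] _]] := hne.
have [|oS [v Sv]] := @tr_neq0_basis _ _ rho0; first by rewrite tr0 oner_neq0.
split.
  move=> rho sigma l /set_mem[dr invr] /set_mem[ds invs]; apply/mem_set.
  have [l0 l1] : 0 <= l%:num /\ 0 <= 1 - l%:num.
    by rewrite subr_ge0.
  have [pr tr_r _] := dr; have [ps tr_s _] := ds.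
  split; first by apply: (density_comb oS Sv) => //; rewrite addrC subrK.
  move=> A t t0; rewrite /conv /= !(tr_comb oS Sv)//.
  by rewrite invr// invs.
move=> X tX CX.
have pX : positive_op X.
  by apply: (limit_positive oS Sv _ CX) => Y [[]].
have eq_rnorm (z w : R[i]) (k : R) :
    (forall e : R, 0 < e -> rnorm (z - w) <= e * k) -> z = w.
  move=> zw; apply/eqP; rewrite -subr_eq0; apply/eqP/rnorm0_eq0/eqP.
  by rewrite eq_le rnorm_ge0 andbT; exact: le0_eps zw.
split; first (split=> //).
  (* At the identity, [tr_dist] is continuity of the trace itself. *)
  have [k hk] := tr_dist oS Sv 1.
  apply: (@eq_rnorm _ _ k) => e /CX[Y [[pY tY trY] _] XY].
  by have := hk _ _ _ pX tX pY tY XY; rewrite !mulr1 trY.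
move=> A t t0.
have [k hk] := tr_dist oS Sv (T t A); have [l hl] := tr_dist oS Sv A.
apply: (@eq_rnorm _ _ (k + l)) => e /CX[Y [[pY tY _] invY] XY].
(* Invariance of [Y] cancels the two inserted terms. *)
have -> : tr (X * T t A) - tr (X * A) =
    (tr (X * T t A) - tr (Y * T t A)) - (tr (X * A) - tr (Y * A)).
  by rewrite invY//; ring.
rewrite (le_trans (rnormD _ _))// rnormN mulrDr.
exact: lerD (hk _ _ _ pX tX pY tY XY) (hl _ _ _ pX tX pY tY XY).
Qed.
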